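(* In the integer setting, given any output $(\hat\pi,u)$ solving the problem $P^{1/n,\,0.1\varepsilon}_{\mathrm{count}}$ (i.e. satisfying its guarantees), one can solve the problem $P^{\mathrm{all}}_{\mathrm{ratio}}$ with accuracy $\varepsilon$ with probability one and with no additional oracle queries.
   Context: Setup. Let $n\ge2$ be an integer, $\mathcal H=\{0,\dots,n\}$, $\varepsilon\in(0,1)$. An instance consists of nonnegative counts $c_x$, $x\in\mathcal H$, not all zero, and reals $\beta_{\min}<\beta_{\max}$. Let $Z(\beta)=\sum_xc_xe^{\beta x}$, $\mu_\beta(x)=c_xe^{\beta x}/Z(\beta)$, $Q(\beta)=Z(\beta)/Z(\beta_{\min})$, $\pi(x)=\mu_{\beta_{\min}}(x)$, $\Delta(x)=\max_{\beta\in[\beta_{\min},\beta_{\max}]}\mu_\beta(x)$. Oracle access: on query $\beta\in[\beta_{\min},\beta_{\max}]$ an oracle returns an independent sample from $\mu_\beta$. The guarantees of $P^{\delta,\varepsilon'}_{\mathrm{count}}$ for vectors $\hat\pi,u$ indexed by $\mathcal H$: (i) for all $x$ with $c_x\ne0$, $|\hat\pi(x)-\pi(x)|\le u(x)\le\varepsilon'\pi(x)(1+\delta/\Delta(x))$; (ii) for all $x$ with $c_x=0$, $\hat\pi(x)=0$. The problem $P^{\mathrm{all}}_{\mathrm{ratio}}$ with accuracy $\varepsilon$: produce a data structure $\mathcal D$ and deterministic function $\alpha\mapsto\hat Q(\alpha\mid\mathcal D)$ such that $|\log\hat Q(\alpha\mid\mathcal D)-\log Q(\alpha)|\le\varepsilon$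 for all $\alpha\in[\beta_{\min},\beta_{\max}]$. *)

(* Defs.v *)
From HB Require Import structures.
From mathcomp Require Import all_boot all_order all_algebra.
From mathcomp Require Import all_classical all_reals all_analysis.

Set Implicit Arguments.
Unset Strict Implicit.
Unset Printing Implicit Defensive.

Import Order.TTheory GRing.Theory Num.Theory.
Import numFieldNormedType.Exports.

Local Open Scope classical_set_scope.
Local Open Scope ring_scope.

Section Gibbs.
Variables (R : realType) (n : nat).

(* The integer setting: the values are {0, ..., n} = 'I_n.+1, and the ordinal
   x is used through its numerical value in the exponent. *)
Implicit Types (c pihat u : 'I_n.+1 -> R) (beta : R) (x : 'I_n.+1).

Definition partition_fun c beta : R :=
  \sum_(x < n.+1) c x * expR (beta * x%:R).

Definition gibbs c beta x : R :=
  c x * expR (beta * x%:R) / partition_fun c beta.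

Definition part_ratio c (bmin beta : R) : R :=
  partition_fun c beta / partition_fun c bmin.

(* The maximum over the interval, written as a supremum;
   [gibbs_peak_attained] below shows that it is attained. *)
Definition gibbs_peak c (bmin bmax : R) x : R :=
  sup [set gibbs c beta x | beta in `[bmin, bmax]].

Definition count_guarantee (delta eps : R) c (bmin bmax : R) pihat u : Prop :=
  (forall x, c x != 0 ->
     `|pihat x - gibbs c bmin x| <= u x /\
     u x <= eps * gibbs c bmin x * (1 + delta / gibbs_peak c bmin bmax x)) /\
  (forall x, c x = 0 -> pihat x = 0).

(* [ln] is 0 on nonpositive reals, so that the estimate of the ratio has
   to be required positive for its logarithm to be meaningful. *)
Definition ratio_all_guarantee (eps : R) c (bmin bmax : R) (qhat : R -> R) :
    Prop :=
  forall alpha, bmin <= alpha <= bmax ->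
    0 < qhat alpha /\ `|ln (qhat alpha) - ln (part_ratio c bmin alpha)| <= eps.

(* Randomized algorithms with access to the sampling oracle: they may return
   a result, flip a fair coin, or query the oracle at a point of
   [bmin, bmax] and continue with the sampled value. The counts are not an
   input, so a program learns about them only from the oracle answers. *)
Inductive oracle_alg (bmin bmax : R) (D : Type) : Type :=
| Return of D
| Flip of (bool -> oracle_alg bmin bmax D)
| Query (beta : R) of bmin <= beta <= bmax &
    ('I_n.+1 -> oracle_alg bmin bmax D).

Fixpoint max_queries (bmin bmax : R) (D : Type)
    (p : oracle_alg bmin bmax D) : nat :=
  match p with
  | Return _ => 0%N
  | Flip k => maxn (max_queries (k true)) (max_queries (k false))
  | Query _ _ k => (\max_(x < n.+1) max_queries (k x)).+1
  end.

(* Probability that the result lies in E when the oracle at beta answers with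
   a sample of [gibbs c beta], independent of all the previous ones. *)
Fixpoint success_prob c (bmin bmax : R) (D : Type) (E : set D)
    (p : oracle_alg bmin bmax D) : R :=
  match p with
  | Return d => \1_E d
  | Flip k => (success_prob c E (k true) + success_prob c E (k false)) / 2
  | Query beta _ k =>
      \sum_(x < n.+1) gibbs c beta x * success_prob c E (k x)
  end.

Lemma partition_fun_gt0 c beta :
  (forall x, 0 <= c x) -> (exists x, c x != 0) -> 0 < partition_fun c beta.
Proof.
move=> c0 [x cx]; rewrite /partition_fun (bigD1 x)//=.
apply: ltr_pwDl; first by rewrite mulr_gt0 ?expR_gt0// lt_def cx c0.
by apply: sumr_ge0 => y _; rewrite mulr_ge0 ?expR_ge0.
Qed.

Lemma gibbs_peak_attained c (bmin bmax : R) x :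
  (forall x, 0 <= c x) -> (exists x, c x != 0) -> bmin <= bmax ->
  exists2 b, bmin <= b <= bmax &
    gibbs_peak c bmin bmax x = gibbs c b x /\
    forall beta, bmin <= beta <= bmax -> gibbs c beta x <= gibbs c b x.
Proof.
move=> c0 cN0 lebb.
have cexp (y : 'I_n.+1) : continuous (fun b : R => c y * expR (b * y%:R)).
  move=> b; apply: cvgM; first exact: cvg_cst.
  apply: (@continuous_comp _ _ _ (fun b : R => b * y%:R) expR).
    by apply: cvgM; [exact: cvg_id | exact: cvg_cst].
  exact: continuous_expR.
have cg : continuous (fun b => gibbs c b x).
  move=> b; apply: cvgM; first exact: cexp.
  apply: cvgV; first by rewrite gt_eqF// partition_fun_gt0.
  by apply: cvg_big => [|y _]; [exact: add_continuous | exact: cexp].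
have [b bI bmaxi] := EVT_max lebb (continuous_subspaceT cg).
exists b; first by move: bI; rewrite in_itv.
have ub beta : bmin <= beta <= bmax -> gibbs c beta x <= gibbs c b x.
  by move=> h; apply: bmaxi; rewrite in_itv.
split=> //; apply/eqP; rewrite eq_le; apply/andP; split.
  apply: ge_sup; first by exists (gibbs c b x); exists b.
  by move=> _ [beta /= h <-]; exact: bmaxi.
apply: ub_le_sup; last by exists b.
by exists (gibbs c b x) => _ [beta /= h <-]; exact: bmaxi.
Qed.

Lemma success_probT c (bmin bmax : R) (D : Type) (p : oracle_alg bmin bmax D) :
  (forall x, 0 <= c x) -> (exists x, c x != 0) ->
  success_prob c setT p = 1.
Proof.
move=> c0 cN0; elim: p => [d|k IH|beta hb k IH] /=.
- by rewrite indicE mem_set.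
- by rewrite !IH divff// pnatr_eq0.
- under eq_bigr do rewrite IH mulr1 /gibbs.
  by rewrite -mulr_suml divff// gt_eqF// partition_fun_gt0.
Qed.

End Gibbs.

(* Main.v *)
Require Import Defs.
From HB Require Import structures.
From mathcomp Require Import all_boot all_order all_algebra.
From mathcomp Require Import all_classical all_reals all_analysis.
From mathcomp Require Import ring lra.

(** Since Q(alpha) mu_alpha(x) = pi(x) e^((alpha - bmin) x), summing over x
    suggests the estimate sum_x pihat(x) e^((alpha - bmin) x) of Q(alpha). The
    error of its x-th term is at most eps' Q(alpha) mu_alpha(x) (1 + delta / Delta(x)),
    and mu_alpha(x) <= Delta(x), so the relative error of the estimate is at most
    eps' (1 + (n + 1) delta), which is at most 3 eps / 10 for eps' = eps / 10
    and delta = 1 / n. *)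

Import Order.TTheory GRing.Theory Num.Theory.
Import numFieldNormedType.Exports.

Local Open Scope classical_set_scope.
Local Open Scope ring_scope.

(** Only [bmin], [alpha] and the vector [p] enter, so the estimate can be evaluated without knowing
    the counts. *)
Definition ratio_estimate {R : realType} {n : nat} (bmin alpha : R)
    (p : 'I_n.+1 -> R) : R :=
  \sum_(x < n.+1) p x * expR ((alpha - bmin) * x%:R).

(** From ln (1 + s) <= s one gets ln x - ln y <= (x - y) / y. For (a, b) this gives t; for (b, a)
    the divisor is a >= (1 - t) b, whence t / (1 - t). *)
Lemma ln_dist_rel_error {R : realType} {a b t : R} :
  0 < b -> t < 1 -> `|a - b| <= t * b ->
  0 < a /\ `|ln a - ln b| <= t / (1 - t).
Proof.
move=> b0 t1; rewrite ler_norml => /andP[lo hi].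
have t0 : 0 <= t by rewrite -(pmulr_lge0 _ b0) mulrC; lra.
have a0 : 0 < a.
  by have : 0 < (1 - t) * b by [rewrite mulr_gt0 ?subr_gt0|]; lra.
split=> //.
have ln_sub (x y : R) : 0 < x -> 0 < y -> ln x - ln y <= (x - y) / y.
  move=> x0 y0; rewrite -ln_div// mulrBl divff ?gt_eqF//.
  rewrite -[X in ln X](subrK 1) addrC; apply: le_ln1Dx.
  by have := divr_gt0 x0 y0; lra.
have le_t : t <= t / (1 - t) by rewrite ler_pdivlMr ?subr_gt0//; nra.
rewrite ler_norml lerNl opprB; apply/andP; split.
  apply: le_trans (ln_sub _ _ b0 a0) _.
  by rewrite ler_pdivrMr// mulrAC ler_pdivlMr ?subr_gt0//; nra.
apply: le_trans le_t; apply: le_trans (ln_sub _ _ a0 b0) _.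
by rewrite ler_pdivrMr//; lra.
Qed.

Section GibbsCounts.
Context {R : realType} {n : nat} {c : 'I_n.+1 -> R}.
Hypotheses (c_ge0 : forall x, 0 <= c x) (c_neq0 : exists x, c x != 0).

Lemma sum_gibbs beta : \sum_(x < n.+1) gibbs c beta x = 1.
Proof. by rewrite -mulr_suml divff// gt_eqF// partition_fun_gt0. Qed.

Lemma part_ratio_gt0 bmin alpha : 0 < part_ratio c bmin alpha.
Proof. by rewrite divr_gt0// partition_fun_gt0. Qed.

(** Both sides equal c(x) e^(alpha x) / Z(bmin). *)
Lemma gibbs_reweight bmin alpha x :
  gibbs c bmin x * expR ((alpha - bmin) * x%:R) =
  part_ratio c bmin alpha * gibbs c alpha x.
Proof.
have Z0 beta : partition_fun c beta != 0 by rewrite gt_eqF// partition_fun_gt0.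
rewrite /gibbs /part_ratio.
have -> : expR (alpha * x%:R) =
    expR (bmin * x%:R) * expR ((alpha - bmin) * x%:R).
  by rewrite -expRD; congr expR; ring.
by field; rewrite !Z0.
Qed.

Lemma ratio_estimate_gibbs bmin alpha :
  ratio_estimate bmin alpha (gibbs c bmin) = part_ratio c bmin alpha.
Proof.
rewrite /ratio_estimate; under eq_bigr do rewrite gibbs_reweight.
by rewrite -mulr_sumr sum_gibbs mulr1.
Qed.

Lemma gibbs_le_peak {bmin bmax alpha} x :
  bmin <= alpha <= bmax -> gibbs c alpha x <= gibbs_peak c bmin bmax x.
Proof.
move=> h; have /andP[h1 h2] := h.
have [b _ [-> ]] := gibbs_peak_attained x c_ge0 c_neq0 (le_trans h1 h2).
exact.
Qed.

Lemma ratio_estimate_rel_error {delta eps bmin bmax alpha : R} {pihat u} :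
  0 <= delta -> 0 <= eps ->
  count_guarantee delta eps c bmin bmax pihat u ->
  bmin <= alpha <= bmax ->
  `|ratio_estimate bmin alpha pihat - part_ratio c bmin alpha| <=
    eps * (1 + n.+1%:R * delta) * part_ratio c bmin alpha.
Proof.
move=> delta0 eps0 [supp off] halpha.
set q := part_ratio c bmin alpha.
have q0 : 0 < q by exact: part_ratio_gt0.
rewrite -[X in `|_ - X|]ratio_estimate_gibbs -sumrB.
apply: le_trans (ler_norm_sum _ _ _) _.
(* The bound is split over the n + 1 terms: the masses mu_alpha(x) add up to 1 and each term
   contributes one [delta]. *)
have -> : eps * (1 + n.+1%:R * delta) * q =
    \sum_(x < n.+1) eps * q * (gibbs c alpha x + delta).
  by rewrite -mulr_sumr big_split/= sum_gibbs sumr_const card_ord -mulr_natl; ring.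
apply: ler_sum => x _.
rewrite -mulrBl normrM (ger0_norm (expR_ge0 _)).
(* Where the count vanishes, [pihat x] and pi(x) are both 0, so the term has no error. *)
have [cx0|cx0] := eqVneq (c x) 0.
  rewrite off// /gibbs cx0 !mul0r subrr normr0 mul0r add0r.
  exact: mulr_ge0 (mulr_ge0 eps0 (ltW q0)) delta0.
have [err_le u_le] := supp x cx0.
apply: le_trans (ler_wpM2r (expR_ge0 _) (le_trans err_le u_le)) _.
rewrite mulrAC -[eps * _ * expR _]mulrA gibbs_reweight -/q.
rewrite mulrA -[leLHS]mulrA ler_wpM2l ?(mulr_ge0 eps0 (ltW q0))//.
(* Positivity of mu_alpha(x) makes the peak positive, so that dividing by it is meaningful; what
   remains is mu_alpha(x) / Delta(x) <= 1. *)
have mu0 : 0 < gibbs c alpha x.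
  by rewrite divr_gt0 ?partition_fun_gt0// mulr_gt0 ?expR_gt0// lt_def cx0 c_ge0.
have le_peak := gibbs_le_peak x halpha.
rewrite mulrDr mulr1 lerD2l mulrCA ler_piMr//.
by rewrite ler_pdivrMr ?mul1r// (lt_le_trans mu0).
Qed.

End GibbsCounts.

Theorem theorem43 (R : realType) (n : nat) (hn : (2 <= n)%N)
    (eps : R) (heps : 0 < eps < 1)
    (bmin bmax : R) (hb : bmin < bmax) :
  exists (D : Type) (Qhat : R -> D -> R)
         (alg : ('I_n.+1 -> R) -> ('I_n.+1 -> R) -> oracle_alg n bmin bmax D),
    forall c : 'I_n.+1 -> R,
      (forall x, 0 <= c x) -> (exists x, c x != 0) ->
    forall pihat u : 'I_n.+1 -> R,
      count_guarantee n%:R^-1 (eps / 10) c bmin bmax pihat u ->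
      max_queries (alg pihat u) = 0%N /\
      success_prob c
        [set d | ratio_all_guarantee eps c bmin bmax (fun alpha => Qhat alpha d)]
        (alg pihat u) = 1.
Proof.
have /andP[eps0 eps1] := heps.
(* The data structure is [pihat] itself, returned at once; it serves every [alpha]
   simultaneously. *)
exists ('I_n.+1 -> R), (ratio_estimate bmin), (fun pihat _ => Return _ _ _ pihat).
move=> c c_ge0 c_neq0 pihat u guarantee; split=> //=.
(* The success probability of a [Return] is an indicator, so the guarantee has to hold outright. *)
rewrite indicE mem_set//= => alpha halpha.
have q0 := part_ratio_gt0 c_ge0 c_neq0 bmin alpha.
have n_ge1 : 1 <= n%:R :> R by rewrite ler1n ltnW.
(* Here (n + 1) / n = 1 + 1 / n <= 2. *)
have le_3 : 1 + n.+1%:R * n%:R^-1 <= 3 :> R.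
  rewrite -lerBrDl ler_pdivrMr ?(lt_le_trans ltr01)// -natr1; lra.
have err : `|ratio_estimate bmin alpha pihat - part_ratio c bmin alpha| <=
    eps / 10 * 3 * part_ratio c bmin alpha.
  apply: le_trans (ratio_estimate_rel_error c_ge0 c_neq0 _ _ guarantee halpha) _;
    rewrite ?invr_ge0//; first by lra.
  by rewrite ler_wpM2r ?(ltW q0)// ler_wpM2l//; lra.
have t1 : eps / 10 * 3 < 1 by lra.
have [pos close] := ln_dist_rel_error q0 t1 err.
split=> //; apply: le_trans close _.
(* With t = 3 eps / 10, t / (1 - t) <= eps amounts to 3 <= 10 - 3 eps, which holds as eps < 1. *)
by rewrite ler_pdivrMr ?subr_gt0//; nra.
Qed.
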